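(* No perfect triangle is isosceles. That is, there is no (non-degenerate) triangle in the Euclidean plane having two sides of equal length whose three side lengths, three median lengths, and area are all rational numbers.
   Context: A median of a triangle is the line segment joining a vertex to the midpoint of the opposite side. A side or a median is called rational if its length is a rational number. A perfect triangle is a triangle with rational sides, rational medians, and rational area. A triangle is isosceles if two of its sides have equal length. *)

(* Defs.v *)
From mathcomp Require Import all_boot all_order all_algebra.
From mathcomp Require Import all_classical all_reals.

Set Implicit Arguments.
Unset Strict Implicit.
Unset Printing Implicit Defensive.

Import Order.TTheory GRing.Theory Num.Theory.
Local Open Scope ring_scope.

Section PlaneTriangles.
Variable R : realType.

(* The Euclidean plane is R^2, as row vectors. The norm on matrices provided by
   MathComp-Analysis is the sup norm, hence an explicit Euclidean distance. *)
Implicit Types A B C P Q : 'rV[R]_2.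

Definition dist P Q : R := Num.sqrt (\sum_(i < 2) (P 0 i - Q 0 i) ^+ 2).

Definition midpoint P Q : 'rV[R]_2 := 2^-1 *: (P + Q).

Definition edge_mx A B C : 'M[R]_2 := col_mx (B - A) (C - A).

(* Non-degeneracy: B - A and C - A are linearly independent. *)
Definition triangle A B C : bool := row_free (edge_mx A B C).

(* Length of the median issued from the first argument. *)
Definition median A B C : R := dist A (midpoint B C).

(* Half the area of the parallelogram spanned by B - A and C - A. *)
Definition area A B C : R := `|\det (edge_mx A B C)| / 2.

Definition isosceles A B C : Prop :=
  [\/ dist A B = dist A C, dist B A = dist B C | dist C A = dist C B].

(* [rational], from mathcomp.reals, is the image of [rat] in R. *)
Definition perfect_triangle A B C : Prop :=
  [/\ triangle A B C,
      [/\ rational (dist B C), rational (dist C A) & rational (dist A B)],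
      [/\ rational (median A B C), rational (median B C A)
        & rational (median C A B)]
    & rational (area A B C)].

End PlaneTriangles.

(* Main.v *)
Require Import Defs.
From mathcomp Require Import all_boot all_order all_algebra.
From mathcomp Require Import all_classical all_reals.
From mathcomp Require Import zify ring lra.

(* With base 2u and altitude h, the equal sides of an isosceles triangle and the
   medians issued from its base have lengths b and m with u^2 + h^2 = b^2 and
   9u^2 + h^2 = (2m)^2, so rational sides and medians yield coprime positive
   integers x, y such that x^2 + y^2 and x^2 + 9y^2 are squares. This is excluded
   by descent on xy. If 3 | x, the pair (y, x/3) is a smaller solution. Otherwise
   parametrize the Pythagorean triples with legs (x, y) and (x, 3y): the even leg
   is 2mk, resp. 2pq, and the relation between mk and pq gives a common
   factorization into pairwise coprime a, b, c, d. If x is even, then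
   a^2(3b^2 - c^2) = d^2(3c^2 - b^2), which is impossible modulo 4; if y is even,
   then b^2(a^2 + d^2) = c^2(9a^2 + d^2), which forces a^2 + d^2 = c^2 and
   9a^2 + d^2 = b^2, a smaller solution (up to exchanging a, b with d, c). *)

Local Open Scope nat_scope.

(** * Coprime factorizations and Pythagorean triples *)

Lemma gcdn_cofactors {m n : nat} : 0 < gcdn m n ->
  exists a b, [/\ coprime a b, m = a * gcdn m n & n = b * gcdn m n].
Proof.
move=> g0; exists (m %/ gcdn m n), (n %/ gcdn m n).
rewrite !divnK ?dvdn_gcdl ?dvdn_gcdr //; split=> //.
by rewrite /coprime -(eqn_pmul2r g0) muln_gcdl !divnK ?dvdn_gcdl ?dvdn_gcdr ?mul1n.
Qed.

(** As [s] and [t] are coprime, s = gcd(s^2, st) = gcd(s^2, r^2) = gcd(s, r)^2. *)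
Lemma coprime_mul_sqr {s t r : nat} :
  coprime s t -> s * t = r ^ 2 -> s = gcdn s r ^ 2.
Proof.
move=> cst Est.
have: gcdn (s * s) (s * t) = s by rewrite -muln_gcdr (eqP cst) muln1.
rewrite Est -!mulnn => {1}<-.
case: (posnP r) => [->|r0]; first by rewrite muln0 !gcdn0 mulnn.
have g0 : 0 < gcdn s r by rewrite gcdn_gt0 r0 orbT.
have [s' [r' [c Es Er]]] := gcdn_cofactors g0.
have c2 : coprime (s' * s') (r' * r') by rewrite !coprimeMl !coprimeMr c.
set g := gcdn s r in g0 Es Er *.
rewrite Es Er [s' * g * _]mulnACA [r' * g * _]mulnACA -muln_gcdl (eqP c2).
by rewrite mul1n.
Qed.

Lemma coprime_not_both_even {a b : nat} : coprime a b -> odd a || odd b.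
Proof.
move=> cab; apply/negPn/negP; rewrite negb_or => /andP[ea eb].
have : 2 %| gcdn a b by rewrite dvdn_gcd !dvdn2 ea eb.
by rewrite (eqP cab).
Qed.

(** The factors (z + y)/2 and (z - y)/2 of (x/2)^2 are coprime, hence squares m^2 and n^2, and they
    differ by y. *)
Lemma pythagorean_triple {x y z : nat} :
  coprime x y -> ~~ odd x -> x ^ 2 + y ^ 2 = z ^ 2 ->
  exists m n, [/\ coprime m n, x = 2 * (m * n) & m ^ 2 = y + n ^ 2].
Proof.
move=> cxy ex Ez.
have oy : odd y by have := coprime_not_both_even cxy; rewrite (negbTE ex).
have oz : odd z by have := congr1 odd Ez; rewrite oddD !oddX /= (negbTE ex) oy.
have yz : y <= z by rewrite -leq_sqr -Ez leq_addl.
set s := (z - y)./2; set t := (z + y)./2; set r := x./2.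
have Es : z = s.*2 + y by rewrite /s; lia.
have Et : t = s + y by rewrite /t; lia.
have Ex : x = r.*2 by rewrite /r; lia.
have Est : t * s = r ^ 2 by nia.
have cts : coprime t s.
  (* The square of gcd(t, s) divides ts = r^2, so the gcd divides r, hence x = 2r; it also divides y
     = t - s. *)
  have: gcdn t s ^ 2 %| r ^ 2.
    by rewrite -Est -mulnn dvdn_mul ?dvdn_gcdl ?dvdn_gcdr.
  rewrite dvdn_pexp2r // => dr.
  have dy : gcdn t s %| y.
    by rewrite -(dvdn_addr y (dvdn_gcdr t s)) -Et dvdn_gcdl.
  have dx : gcdn t s %| x by rewrite Ex -muln2 dvdn_mulr.
  by have := dvdn_gcd (gcdn t s) x y; rewrite dx dy (eqP cxy) dvdn1.
have Em := coprime_mul_sqr cts Est.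
have En : s = gcdn s r ^ 2.
  by apply: (@coprime_mul_sqr s t r); rewrite 1?coprime_sym // mulnC.
exists (gcdn t r), (gcdn s r); split.
- exact: coprime_dvdl (dvdn_gcdl t r) (coprime_dvdr (dvdn_gcdl s r) cts).
- apply/eqP; rewrite Ex -muln2 mulnC eqn_pmul2l // -(@eqn_exp2r _ _ 2) //.
  by rewrite expnMn -Em -En Est.
- by rewrite -Em -En Et addnC.
Qed.

(** Take a = gcd(m, p) with coprime cofactors b and c; then bn = cq forces c to divide n, and d is
    the quotient. *)
Lemma four_numbers {m n p q : nat} : 0 < m -> 0 < p -> m * n = p * q ->
  exists a b c d, [/\ m = a * b, n = c * d, p = a * c & q = b * d].
Proof.
move=> m0 p0 E.
have g0 : 0 < gcdn m p by rewrite gcdn_gt0 m0.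
have [b [c [cbc Em Ep]]] := gcdn_cofactors g0.
set g := gcdn m p in g0 Em Ep.
have Ebc : b * n = c * q.
  by apply/eqP; rewrite -(eqn_pmul2l g0); apply/eqP; nia.
have /dvdnP[d Ed] : c %| n.
  by rewrite -(@Gauss_dvdr c b) 1?coprime_sym // Ebc dvdn_mulr.
have c0 : 0 < c by nia.
exists g, b, c, d; split; rewrite 1?[g * _]mulnC // 1?[c * _]mulnC //.
by apply/eqP; rewrite -(eqn_pmul2l c0) -Ebc Ed; apply/eqP; nia.
Qed.

Lemma coprime_four {a b c d : nat} :
  coprime (a * b) (c * d) -> coprime (a * c) (b * d) ->
  [/\ coprime a b, coprime a c, coprime a d
    & [/\ coprime b c, coprime b d & coprime c d]].
Proof.
rewrite !coprimeMl !coprimeMr.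
move=> /andP[/andP[ac ad] /andP[bc bd]] /andP[/andP[ab _] /andP[_ cd]].
by split.
Qed.

(** * Residues and divisors of squares *)

Lemma odd_sqr_mod8 {a : nat} : odd a -> exists k, a ^ 2 = 8 * k + 1.
Proof.
move=> oa; have [j Ej] : exists j, a = 2 * j + 1 by exists a./2; lia.
have [k Ek] : exists k, j * j.+1 = 2 * k.
  by exists (j * j.+1)./2; have := oddM j j.+1; rewrite /= andbN; lia.
by exists k; rewrite Ej; nia.
Qed.

Lemma even_sqr_mod4 {a : nat} : ~~ odd a -> exists k, a ^ 2 = 4 * k.
Proof.
by move=> ea; exists (a./2 ^ 2); rewrite -(expnMn 2 _ 2); congr (_ ^ 2); lia.
Qed.

Lemma dvdn_coprime8_sqr {k a d : nat} :
  odd k -> coprime a d -> k %| 8 * a ^ 2 -> k %| 8 * d ^ 2 -> k = 1.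
Proof.
move=> ok cad.
have ck : coprime k 8 by rewrite (@coprime_pexpr 3 k 2) // coprimen2.
rewrite !(Gauss_dvdr _ ck) => ka kd; apply/eqP.
have := dvdn_gcd k (a ^ 2) (d ^ 2).
have c2 : coprime (a ^ 2) (d ^ 2) by rewrite coprimeXl ?coprimeXr.
by rewrite ka kd (eqP c2) dvdn1.
Qed.

(** * The equations between the four factors *)

Lemma cross_proportional {b c u v : nat} : 0 < c -> coprime b c ->
  b * u = c * v -> exists k, u = k * c /\ v = k * b.
Proof.
move=> c0 cbc E.
have /dvdnP[k Eu] : c %| u.
  by rewrite -(@Gauss_dvdr c b) 1?coprime_sym // E dvdn_mulr.
exists k; split=> //; apply/eqP.
by rewrite -(eqn_pmul2l c0) -E Eu; apply/eqP; lia.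
Qed.

(** The last equation is 3((ab)^2 - (cd)^2) = (ac)^2 - (bd)^2, two expressions of 3y, written
    without subtraction. *)
Lemma four_factors_even_leg_false {a b c d : nat} : 0 < a -> 0 < b -> 0 < c -> 0 < d ->
  coprime (a * b) (c * d) -> coprime (a * c) (b * d) ->
  ~~ odd (a * b * (c * d)) ->
  a ^ 2 * (3 * b ^ 2) + d ^ 2 * b ^ 2 = a ^ 2 * c ^ 2 + d ^ 2 * (3 * c ^ 2) ->
  False.
Proof.
move=> a0 b0 c0 d0 c1 c2 ev E.
have [ab ac ad [bc bd cd]] := coprime_four c1 c2.
(* 3b^2 - c^2 and 3c^2 - b^2 have the same sign and cannot both be negative, so the truncated
   subtractions below are exact. *)
have le1 : c ^ 2 <= 3 * b ^ 2 by nia.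
have c22 : coprime (a ^ 2) (d ^ 2) by rewrite coprimeXl ?coprimeXr.
have E' : a ^ 2 * (3 * b ^ 2 - c ^ 2) = d ^ 2 * (3 * c ^ 2 - b ^ 2) by nia.
have [|k [Ed Ea]] := cross_proportional _ c22 E'; first by nia.
have {}Ed : 3 * b ^ 2 = c ^ 2 + k * d ^ 2 by lia.
have {}Ea : 3 * c ^ 2 = b ^ 2 + k * a ^ 2 by nia.
(* Eliminating c, resp. b, gives 8b^2 = k(3d^2 + a^2) and 8c^2 = k(3a^2 + d^2). *)
have k1 : odd k -> k = 1.
  move=> ok; apply: (dvdn_coprime8_sqr ok bc); apply/dvdnP.
    by exists (3 * d ^ 2 + a ^ 2); nia.
  by exists (3 * a ^ 2 + d ^ 2); nia.
have oab := coprime_not_both_even ab; have oac := coprime_not_both_even ac.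
have obc := coprime_not_both_even bc.
have obd := coprime_not_both_even bd; have ocd := coprime_not_both_even cd.
move: ev; rewrite !oddM => ev.
(* In each remaining parity case, [Ed] or [Ea] reads 3 = 1 modulo 4. *)
case ob: (odd b) => //; case oc: (odd c) => //; last 1 first.
- by rewrite ob oc in obc.
- have [i Ei] := odd_sqr_mod8 ob; have [j Ej] := odd_sqr_mod8 oc.
  have [oa|ea] := boolP (odd a).
    have ed : ~~ odd d by move: ev; rewrite oa ob oc.
    by have [l El] := even_sqr_mod4 ed; rewrite El in Ed; clear - Ed Ei Ej; lia.
  by have [l El] := even_sqr_mod4 ea; rewrite El in Ea; clear - Ea Ei Ej; lia.
- have oa : odd a by move: oac; rewrite oc orbF.
  have od : odd d by move: ocd; rewrite oc.
  have [i Ei] := odd_sqr_mod8 ob; have [j Ej] := even_sqr_mod4 (negbT oc).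
  have [l El] := odd_sqr_mod8 oa; have [m Em] := odd_sqr_mod8 od.
  have /k1 Ek : odd k.
    by have := congr1 odd Ed; rewrite oddD !oddM ob oc od; case: (odd k).
  by rewrite Ek Em in Ed; clear - Ed Ei Ej; lia.
- have oa : odd a by move: oab; rewrite ob orbF.
  have od : odd d by move: obd; rewrite ob.
  have [i Ei] := odd_sqr_mod8 oc; have [j Ej] := even_sqr_mod4 (negbT ob).
  have [l El] := odd_sqr_mod8 oa; have [m Em] := odd_sqr_mod8 od.
  have /k1 Ek : odd k.
    by have := congr1 odd Ea; rewrite oddD !oddM ob oc oa; case: (odd k).
  by rewrite Ek El in Ea; clear - Ea Ei Ej; lia.
Qed.

(** The last hypothesis equates two expressions of x, (ab)^2 - (cd)^2 and (3ac)^2 - (bd)^2.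
    Coprimality of b^2 and c^2 gives a^2 + d^2 = kc^2 and 9a^2 + d^2 = kb^2; then k divides 8a^2 and
    8d^2, so k = 1 once k is odd. *)
Lemma four_factors_odd_leg {a b c d : nat} : 0 < a -> 0 < b -> 0 < c -> 0 < d ->
  coprime (a * b) (c * d) ->
  ~~ odd (a * b * (c * d)) ->
  b ^ 2 * (a ^ 2 + d ^ 2) = c ^ 2 * (9 * a ^ 2 + d ^ 2) ->
  a ^ 2 + d ^ 2 = c ^ 2 /\ 9 * a ^ 2 + d ^ 2 = b ^ 2.
Proof.
move=> a0 b0 c0 d0 c1 ev E.
have [ad bc] : coprime a d /\ coprime b c.
  by move: c1; rewrite coprimeMl !coprimeMr => /andP[/andP[_ ->] /andP[->]].
have c2 : coprime (b ^ 2) (c ^ 2) by rewrite coprimeXl ?coprimeXr.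
have [|k [E1 E2]] := cross_proportional _ c2 E; first by nia.
suff ok : odd k.
  have Ek : k = 1.
    apply: (dvdn_coprime8_sqr ok ad); apply/dvdnP.
      by exists (b ^ 2 - c ^ 2); nia.
    by exists (9 * c ^ 2 - b ^ 2); nia.
  by rewrite E1 E2 Ek !mul1n.
have obc := coprime_not_both_even bc; have oad := coprime_not_both_even ad.
move: ev; rewrite !oddM => ev.
(* If a and d are odd, both sums are 2 modulo 4, but b or c is even, which makes kb^2 or kc^2
   divisible by 4. Otherwise a^2 + d^2 is odd, and so is k. *)
have [|nad] := boolP (odd a && odd d).
  move=> /andP[oa od].
  have [i Ei] := odd_sqr_mod8 oa; have [j Ej] := odd_sqr_mod8 od.
  have [oc|ec] := boolP (odd c).
    have eb : ~~ odd b by move: ev; rewrite oa od oc; case: (odd b).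
    by have [l El] := even_sqr_mod4 eb; rewrite El in E2;
      exfalso; clear - E2 Ei Ej; lia.
  by have [l El] := even_sqr_mod4 ec; rewrite El in E1;
    exfalso; clear - E1 Ei Ej; lia.
have : odd (a ^ 2 + d ^ 2).
  by rewrite oddD !oddX /=; case: (odd a) (odd d) nad oad => [] [].
by rewrite E1 oddM => /andP[].
Qed.

(** * The descent over the integers *)

Lemma even_mul_of_odd_diff {m n y : nat} :
  odd y -> m ^ 2 = y + n ^ 2 -> ~~ odd (m * n).
Proof.
move=> oy /(congr1 odd); rewrite oddD !oddX /= oy oddM.
by case: (odd m) (odd n) => [] [].
Qed.

Lemma coprime_concordant_descent (n x y z w : nat) :
  x * y < n -> 0 < x -> 0 < y -> coprime x y ->
  x ^ 2 + y ^ 2 = z ^ 2 -> x ^ 2 + 9 * y ^ 2 = w ^ 2 -> False.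
Proof.
elim: n x y z w => // n IHn x y z w lt_xy x0 y0 cxy Ez Ew.
have [/dvdnP[x' Ex]|n3x] := boolP (3 %| x).
  have /dvdnP[w' Ew'] : 3 %| w.
    rewrite -(@dvdn_pexp2r _ _ 2) // -Ew Ex; apply/dvdnP.
    by exists (x' ^ 2 + y ^ 2); lia.
  have x'0 : 0 < x' by lia.
  have cyx' : coprime y x'.
    by move: cxy; rewrite Ex coprimeMl coprime_sym => /andP[].
  by apply: (IHn y x' w' z) => //; rewrite Ex ?Ew' in lt_xy Ez Ew *; nia.
(* As 3 does not divide x, the triple with legs x and 3y is primitive too. *)
have cx3y : coprime x (3 * y).
  by rewrite coprimeMr cxy coprime_sym prime_coprime // n3x.
have Ew3 : x ^ 2 + (3 * y) ^ 2 = w ^ 2 by rewrite expnMn.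
have oxy := coprime_not_both_even cxy.
have [ox|ex] := boolP (odd x); last first.
  have [m [k [cmk Exmk Em]]] := pythagorean_triple cxy ex Ez.
  have [p [q [cpq Expq Ep]]] := pythagorean_triple cx3y ex Ew3.
  have /andP[m0 k0] : (0 < m) && (0 < k) by move: x0; rewrite Exmk !muln_gt0.
  have /andP[p0 q0] : (0 < p) && (0 < q) by move: x0; rewrite Expq !muln_gt0.
  have oy : odd y by move: oxy; rewrite (negbTE ex).
  have ev := even_mul_of_odd_diff oy Em.
  have [|a [b [c [d [? ? ? ?]]]]] := four_numbers m0 p0 (n := k) (q := q).
    by lia.
  subst m k p q; move: m0 k0; rewrite !muln_gt0 => /andP[a0 b0] /andP[c0 d0].
  apply: (four_factors_even_leg_false a0 b0 c0 d0 cmk cpq ev).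
  by rewrite !expnMn in Em Ep; clear - Em Ep; lia.
(* Two odd legs would give z^2 = 2 modulo 8, which is not a square. *)
have [oy|ey] := boolP (odd y).
  have [i Ei] := odd_sqr_mod8 ox; have [j Ej] := odd_sqr_mod8 oy.
  have [oz|ez] := boolP (odd z).
    by have [l El] := odd_sqr_mod8 oz; clear - Ez Ei Ej El; lia.
  by have [l El] := even_sqr_mod4 ez; clear - Ez Ei Ej El; lia.
have cyx : coprime y x by rewrite coprime_sym.
have c3yx : coprime (3 * y) x by rewrite coprime_sym.
have e3y : ~~ odd (3 * y) by rewrite oddM.
rewrite addnC in Ez; rewrite addnC in Ew3.
have [m [k [cmk Eymk Em]]] := pythagorean_triple cyx ey Ez.
have [p [q [cpq Eypq Ep]]] := pythagorean_triple c3yx e3y Ew3.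
have /andP[m0 k0] : (0 < m) && (0 < k) by move: y0; rewrite Eymk !muln_gt0.
have y30 : 0 < 3 * y by rewrite muln_gt0.
have /andP[p0 q0] : (0 < p) && (0 < q) by move: y30; rewrite Eypq !muln_gt0.
have ev := even_mul_of_odd_diff ox Em.
have Epq : 3 * (m * k) = p * q by lia.
have lt_y : y < n.+1 by apply: leq_ltn_trans lt_xy; rewrite leq_pmull.
(* Cancelling the 3 from p or from q yields a product equal to mk, to which [four_numbers]
   applies. *)
have : 3 %| p * q by rewrite -Epq dvdn_mulr.
rewrite Euclid_dvdM // => /orP[] /dvdnP[r Er].
  have r0 : 0 < r by lia.
  have [|a [b [c [d [? ? ? ?]]]]] := four_numbers m0 r0 (n := k) (q := q).
    by lia.
  subst m k r q p; move: m0 k0; rewrite !muln_gt0 => /andP[a0 b0] /andP[c0 d0].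
  have [|Ec Eb] := four_factors_odd_leg a0 b0 c0 d0 cmk ev.
    by rewrite !expnMn in Em Ep; clear - Em Ep; lia.
  have cda : coprime d a.
    rewrite coprime_sym; move: cmk.
    by rewrite coprimeMl !coprimeMr => /andP[/andP[_ ->]].
  (* The descent is strict because y = 2abcd, so that da < y <= xy. *)
  have lt_da : d * a < n.
    have := leq_pmulr (d * a) (n := b * c); rewrite muln_gt0 b0 c0 => /(_ isT).
    by move: y0; rewrite Eymk in lt_y *; clear - lt_y; lia.
  by apply: (IHn d a c b lt_da) => //; rewrite addnC.
have r0 : 0 < r by lia.
have [|a [b [c [d [? ? ? ?]]]]] := four_numbers m0 p0 (n := k) (q := r).
  by lia.
subst m k p r q; move: m0 k0; rewrite !muln_gt0 => /andP[a0 b0] /andP[c0 d0].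
have c' : coprime (d * c) (b * a) by rewrite coprime_sym mulnC [d * c]mulnC.
have ev' : ~~ odd (d * c * (b * a)) by rewrite mulnC [d * c]mulnC [b * a]mulnC.
(* With q = 3bd the factor 9 falls on d^2 instead of a^2, hence the exchange of a, b with d, c. *)
have [|Ec Eb] := four_factors_odd_leg d0 c0 b0 a0 c' ev'.
  by rewrite !expnMn in Em Ep; clear - Em Ep; lia.
have cad : coprime a d.
  by move: cmk; rewrite coprimeMl !coprimeMr => /andP[/andP[_ ->]].
have lt_ad : a * d < n.
  have := leq_pmulr (a * d) (n := b * c); rewrite muln_gt0 b0 c0 => /(_ isT).
  by move: y0; rewrite Eymk in lt_y *; clear - lt_y; lia.
by apply: (IHn a d b c lt_ad) => //; rewrite addnC.
Qed.

Lemma no_concordant_nat (x y z w : nat) : 0 < x -> 0 < y ->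
  x ^ 2 + y ^ 2 = z ^ 2 -> x ^ 2 + 9 * y ^ 2 = w ^ 2 -> False.
Proof.
move=> x0 y0 Ez Ew.
have g0 : 0 < gcdn x y by rewrite gcdn_gt0 x0.
have [x' [y' [cxy Ex Ey]]] := gcdn_cofactors g0.
move: (gcdn x y) g0 Ex Ey => g g0 Ex Ey; subst x y.
have /dvdnP[z' Ez'] : g %| z.
  rewrite -(@dvdn_pexp2r _ _ 2) // -Ez; apply/dvdnP.
  by exists (x' ^ 2 + y' ^ 2); rewrite mulnDl !expnMn.
have /dvdnP[w' Ew'] : g %| w.
  rewrite -(@dvdn_pexp2r _ _ 2) // -Ew; apply/dvdnP.
  by exists (x' ^ 2 + 9 * y' ^ 2); rewrite mulnDl !expnMn mulnA.
have g20 : 0 < g ^ 2 by rewrite expn_gt0 g0.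
move: x0 y0; rewrite !muln_gt0 => /andP[x0 _] /andP[y0 _].
apply: (coprime_concordant_descent _ x' y' z' w' (ltnSn _) x0 y0 cxy).
  by apply/eqP; rewrite -(eqn_pmul2r g20) mulnDl -!expnMn Ez Ez'.
by apply/eqP; rewrite -(eqn_pmul2r g20) mulnDl -mulnA -!expnMn Ew Ew'.
Qed.

(** * From natural to rational numbers *)

Local Open Scope ring_scope.
Import Order.TTheory GRing.Theory Num.Theory.

Lemma norm_rat_frac (q : rat) : exists (k d : nat), (0 < d)%N /\ `|q| * d%:R = k%:R.
Proof.
exists `|numq q|%N, `|denq q|%N; split; first by rewrite absz_gt0 denq_eq0.
rewrite -[X in `|X| * _]divq_num_den -[`|denq q|%N%:R]/(`|denq q|%N%:Z%:~R).
rewrite -[`|numq q|%N%:R]/(`|numq q|%N%:Z%:~R) !abszE normrM normfV -!intr_norm.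
by rewrite mulfVK // intr_eq0 normr_eq0 denq_eq0.
Qed.

Lemma no_concordant_rat (x y z w : rat) : x != 0 -> y != 0 ->
  x ^+ 2 + y ^+ 2 = z ^+ 2 -> x ^+ 2 + 9 * y ^+ 2 = w ^+ 2 -> False.
Proof.
move=> x0 y0.
have sqn (q : rat) : q ^+ 2 = `|q| ^+ 2 by rewrite real_normK ?num_real.
rewrite -normr_gt0 in x0; rewrite -normr_gt0 in y0.
rewrite (sqn x) (sqn y) (sqn z) (sqn w) => Ez Ew.
have [kx [dx [dx0 Ex]]] := norm_rat_frac x.
have [ky [dy [dy0 Ey]]] := norm_rat_frac y.
have [kz [dz [dz0 Ez']]] := norm_rat_frac z.
have [kw [dw [dw0 Ew']]] := norm_rat_frac w.
(* These are the four absolute values multiplied by the common denominator [dx * dy * dz * dw]. *)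
apply: (no_concordant_nat (kx * (dy * dz * dw)) (ky * (dx * dz * dw))
  (kz * (dx * dy * dw)) (kw * (dx * dy * dz))).
- rewrite !muln_gt0 dy0 dz0 dw0 !andbT -(@ltr0n rat) -Ex.
  by rewrite mulr_gt0 ?ltr0n.
- rewrite !muln_gt0 dx0 dz0 dw0 !andbT -(@ltr0n rat) -Ey.
  by rewrite mulr_gt0 ?ltr0n.
- apply/eqP; rewrite -(eqr_nat rat) natrD !natrX !natrM -Ex -Ey -Ez'; apply/eqP.
  transitivity ((`|x| ^+ 2 + `|y| ^+ 2) * (dx%:R * dy%:R * dz%:R * dw%:R) ^+ 2).
    by ring.
  by rewrite Ez; ring.
- apply/eqP; rewrite -(eqr_nat rat) natrD natrM !natrX !natrM -Ex -Ey -Ew'; apply/eqP.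
  transitivity ((`|x| ^+ 2 + 9 * `|y| ^+ 2) * (dx%:R * dy%:R * dz%:R * dw%:R) ^+ 2).
    by ring.
  by rewrite Ew; ring.
Qed.

(** * Triangles in coordinates *)

Section Coordinates.
Variable R : realType.
Implicit Types A B C P Q : 'rV[R]_2.

Lemma dist_sqr P Q :
  dist P Q ^+ 2 = (P 0 0 - Q 0 0) ^+ 2 + (P 0 1 - Q 0 1) ^+ 2.
Proof.
rewrite /dist sqr_sqrtr; last by apply: sumr_ge0 => i _; apply: sqr_ge0.
by rewrite big_ord_recl big_ord1; congr (_ + (P 0 _ - Q 0 _) ^+ 2); apply: val_inj.
Qed.

Lemma midpointE P Q i : midpoint P Q 0 i = (P 0 i + Q 0 i) / 2.
Proof. by rewrite !mxE mulrC. Qed.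

(** Twice the signed area of the triangle. *)
Definition cross A B C : R :=
  (B 0 0 - A 0 0) * (C 0 1 - A 0 1) - (B 0 1 - A 0 1) * (C 0 0 - A 0 0).

Lemma cross_rotate A B C : cross B C A = cross A B C.
Proof. by rewrite /cross; ring. Qed.

Lemma triangle_cross A B C : triangle A B C -> cross A B C != 0.
Proof.
have E0 j : edge_mx A B C 0 j = B 0 j - A 0 j.
  have <- : (B - A) 0 j = B 0 j - A 0 j by rewrite !mxE.
  rewrite -(col_mxEu (B - A) (C - A)); congr (edge_mx A B C _ j); exact: val_inj.
have E1 j : edge_mx A B C 1 j = C 0 j - A 0 j.
  have <- : (C - A) 0 j = C 0 j - A 0 j by rewrite !mxE.
  rewrite -(col_mxEd (B - A) (C - A)); congr (edge_mx A B C _ j); exact: val_inj.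
have -> : cross A B C = \det (edge_mx A B C).
  move: (edge_mx A B C) E0 E1 => M E0 E1.
  rewrite (expand_det_row _ 0) big_ord_recl big_ord1 /cofactor !det_mx11 !mxE.
  have -> : lift ord0 0 = 1 :> 'I_2 by apply: val_inj.
  have -> : lift 1 0 = 0 :> 'I_2 by apply: val_inj.
  by rewrite !E0 !E1 /cross /=; ring.
by rewrite /triangle row_free_unit unitmxE unitfE.
Qed.

(* In general |BC|^2 median^2 = cross^2 + ((|AB|^2 - |AC|^2) / 2)^2. *)
Lemma cross_sqr_isosceles A B C : dist A B = dist A C ->
  cross A B C ^+ 2 = dist B C ^+ 2 * median A B C ^+ 2.
Proof.
move=> /(congr1 (fun t => t ^+ 2)); rewrite /median !dist_sqr !midpointE /cross => E.
transitivity (((B 0 0 - C 0 0) ^+ 2 + (B 0 1 - C 0 1) ^+ 2) *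
  ((A 0 0 - (B 0 0 + C 0 0) / 2) ^+ 2 + (A 0 1 - (B 0 1 + C 0 1) / 2) ^+ 2) -
  (((A 0 0 - B 0 0) ^+ 2 + (A 0 1 - B 0 1) ^+ 2) -
   ((A 0 0 - C 0 0) ^+ 2 + (A 0 1 - C 0 1) ^+ 2)) ^+ 2 / 4); first by field.
by rewrite E subrr expr0n mul0r subr0.
Qed.

Lemma apollonius A B C :
  4 * median A B C ^+ 2 = 2 * dist A B ^+ 2 + 2 * dist A C ^+ 2 - dist B C ^+ 2.
Proof. by rewrite /median !dist_sqr !midpointE; field. Qed.

Lemma dist_sym P Q : dist P Q = dist Q P.
Proof. by rewrite /dist; congr Num.sqrt; apply: eq_bigr => i _; ring. Qed.

(** Let a = BC, b = AB, and let h, m be the medians from A and B. If [cross] is nonzero, so are a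
    and h, and Apollonius gives h^2 + (a/2)^2 = b^2 and h^2 + 9(a/2)^2 = (2m)^2. *)
Lemma isosceles_rational_medians_degenerate A B C :
  dist A B = dist A C -> rational (dist B C) -> rational (dist A B) ->
  rational (median A B C) -> rational (median B C A) -> cross A B C = 0.
Proof.
move=> iso [a _ Ea] [b _ Eb] [h _ Eh] [m _ Em].
apply/eqP; apply: contraT => D0.
have := cross_sqr_isosceles A B C iso; rewrite -Ea -Eh => ED.
have a0 : a != 0.
  by apply: contraNneq D0 => a0; rewrite -sqrf_eq0 ED a0 rmorph0 expr0n mul0r.
have h0 : h != 0.
  by apply: contraNneq D0 => h0; rewrite -sqrf_eq0 ED h0 rmorph0 expr0n mulr0.
(* Both relations hold between lengths in [R] and are pulled back to [rat] by injectivity of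
   [ratr]. *)
have E1 : 4 * h ^+ 2 = 4 * b ^+ 2 - a ^+ 2.
  apply: (fmorph_inj (@ratr R)).
  rewrite !(rmorph_nat, rmorphM, rmorphB, rmorphXn) /=.
  by rewrite Ea Eb Eh apollonius -iso; ring.
have E2 : 4 * m ^+ 2 = 2 * a ^+ 2 + b ^+ 2.
  apply: (fmorph_inj (@ratr R)).
  rewrite !(rmorph_nat, rmorphM, rmorphD, rmorphXn) /=.
  by rewrite Ea Eb Em apollonius (dist_sym B A) (dist_sym C A) -iso; ring.
case: (@no_concordant_rat h (a / 2) b (2 * m)) => //.
- by rewrite mulf_neq0.
- by lra.
- by lra.
Qed.

End Coordinates.

Theorem theorem1p2 (R : realType) (A B C : 'rV[R]_2) :
  perfect_triangle A B C -> ~ isosceles A B C.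
Proof.
move=> [/triangle_cross /negP tABC [rBC rCA rAB] [mA mB mC] _] iso; apply: tABC.
apply/eqP; case: iso => iso.
- exact: isosceles_rational_medians_degenerate.
(* An apex at B or C is brought to first position by a cyclic relabelling, which preserves
   [cross]. *)
- by rewrite -cross_rotate; apply: isosceles_rational_medians_degenerate.
- by rewrite (@cross_rotate R C A B); apply: isosceles_rational_medians_degenerate.
Qed.
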